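(* Let $F=\frac1n\sum_{i=1}^nF_i$ be $\ell$-star-cocoercive. Assume that there exists a constant $\widehat\ell>0$ such that for all $x\in\mathbb{R}^d$, with $x^*=\mathrm{proj}_{X^*}(x)$, $$\frac1n\sum_{i=1}^n\|F_i(x)-F_i(x^* )\|^2\le\widehat\ell\,\langle F(x)-F(x^* ),x-x^*\rangle,$$ and that all stochastic realizations $g_i^k$ are unbiased and have bounded variance, i.e. for all $i\in\{1,\dots,n\}$ and $k\ge0$ $$\mathbb{E}[g_i^k]=F_i(x^k),\qquad\mathbb{E}\left[\|g_i^k-F_i(x^k)\|^2\right]\le\sigma_i^2.$$ Then QSGDA satisfies the key parametric assumption with $$A=\frac{3\ell}{2}+\frac{9\omega\widehat\ell}{2n},\quad B=0,\quad\sigma_k^2\equiv0,\quad D_1=\frac{3(1+3\omega)\sigma^2+9\omega\zeta_*^2}{n},\quad C=0,\quad\rho=1,\quad D_2=0,$$ where $\sigma^2=\frac1n\sum_{i=1}^n\sigma_i^2$ and $\zeta_*^2=\frac1n\max_{x^*\in X^*}\sum_{i=1}^n\|F_i(x^* )\|^2$.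
   Context: Norms and inner products on $\mathbb{R}^d$ are Euclidean. $F,F_1,\dots,F_n:\mathbb{R}^d\to\mathbb{R}^d$ are operators, the $F_i$ being distributed across $n$ devices (workers) connected with a server, and $R:\mathbb{R}^d\to\mathbb{R}$ is a regularization term, a proper lower semicontinuous convex function. $X^*$ is the set of solutions (assumed nonempty) of the regularized variational inequality: find $x^*\in\mathbb{R}^d$ with $\langle F(x^* ),x-x^*\rangle+R(x)-R(x^* )\ge0$ for all $x\in\mathbb{R}^d$. $\mathrm{proj}_{X^*}(x)=\arg\min_{y\in X^*}\|y-x\|$. $F$ is $\ell$-star-cocoercive ($\ell>0$) if $\|F(x)-F(x^* )\|^2\le\ell\langle F(x)-F(x^* ),x-x^*\rangle$ for all $x\in\mathbb{R}^d$, where $x^*=\mathrm{proj}_{X^*}(x)$. A (possibly randomized) operator $\mathcal{Q}:\mathbb{R}^d\to\mathbb{R}^d$ is an unbiased compressor (quantization) if there is a constant $\omega\ge0$ such that $\mathbb{E}[\mathcal{Q}(x)]=x$ and $\mathbb{E}[\|\mathcal{Q}(x)-x\|^2]\le\omega\|x\|^2$ for all $x\in\mathbb{R}^d$. QSGDA, with stepsize $\gamma>0$ and such a $\mathcal{Q}$ with constant $\omega$: at iteration $k$ the server broadcasts $x^k$ to all workers; each worker $i=1,\dots,n$ in parallel computes a stochastic estimator $g_i^k$ of $F_i(x^k)$ and sends $\mathcal{Q}(g_i^k)$ to the server; then $g^k=\frac1n\sum_{i=1}^n\mathcal{Q}(g_i^k)$ and $x^{k+1}=\mathrm{prox}_{\gamma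 R}(x^k-\gamma g^k)$, where $\mathrm{prox}_{\gamma R}(x)=\arg\min_{y\in\mathbb{R}^d}\{R(y)+\|y-x\|^2/(2\gamma)\}$. Put $x^{*,k}=\mathrm{proj}_{X^*}(x^k)$ and $g^{*,k}=F(x^{*,k})$. $\mathbb{E}_k[\cdot]$ denotes the expectation with respect to the randomness at iteration $k$. Key parametric assumption (with constants $A,B,C,D_1,D_2\ge0$, $\rho\in(0,1]$ and a sequence of possibly random nonnegative variables $\{\sigma_k\}_{k\ge0}$): for all $k\ge0$, $\mathbb{E}_k[g^k]=F(x^k)$ and $$\mathbb{E}_k\left[\|g^k-g^{*,k}\|^2\right]\le2A\langle F(x^k)-g^{*,k},x^k-x^{*,k}\rangle+B\sigma_k^2+D_1,$$ $$\mathbb{E}_k[\sigma_{k+1}^2]\le2C\langle F(x^k)-g^{*,k},x^k-x^{*,k}\rangle+(1-\rho)\sigma_k^2+D_2.$$ (The variables $\sigma_k$ here are unrelated to the variance bounds $\sigma_i$ of the workers.)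
   Formalization: Added assumption: at each iteration, given the past, the estimators g_i^k and the workers' quantization randomness are mutually independent (the bound fails otherwise, e.g. n=4, ω=0, identical noise in all workers); Q is also taken jointly measurable in its randomness and argument. *)

(* Defs.v *)
From HB Require Import structures.
From mathcomp Require Import all_boot all_order all_algebra.
From mathcomp Require Import all_classical all_reals all_analysis.
Set Implicit Arguments.
Unset Strict Implicit.
Unset Printing Implicit Defensive.
Import Order.TTheory GRing.Theory Num.Theory.
Import numFieldNormedType.Exports.
Local Open Scope classical_set_scope.
Local Open Scope ring_scope.

(* The vectors of R^d are the row vectors 'rV[R]_d. The norm that the library
   puts on matrices is the sup norm, so the Euclidean structure is defined
   here. *)
Definition inner (R : realType) (d : nat) (u v : 'rV[R]_d) : R :=
  \sum_(i < d) u ord0 i * v ord0 i.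

Definition enorm (R : realType) (d : nat) (u : 'rV[R]_d) : R :=
  Num.sqrt (inner u u).

(* The product sigma-algebra on row vectors, generated by the coordinates (for
   R : realType, this is the Borel sigma-algebra of R^d). The library has the
   same construction for tuples. *)
Definition measure_rV_display : measure_display -> measure_display.
Proof. exact. Qed.

Section measurable_rV.
Context {disp : measure_display} {T : measurableType disp}.
Variable n : nat.

Let coors : 'I_n -> 'rV[T]_n -> T := fun i x => x ord0 i.

Let rV_set0 : g_sigma_preimage coors set0.
Proof. exact: sigma_algebra0. Qed.

Let rV_setC A : g_sigma_preimage coors A -> g_sigma_preimage coors (~` A).
Proof. exact: sigma_algebraC. Qed.

Let rV_bigcup (F : (set 'rV[T]_n)^nat) :
  (forall i, g_sigma_preimage coors (F i)) ->
  g_sigma_preimage coors (\bigcup_i (F i)).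
Proof. exact: sigma_algebra_bigcup. Qed.

HB.instance Definition _ := @isMeasurable.Build (measure_rV_display disp)
  'rV[T]_n (g_sigma_preimage coors) rV_set0 rV_setC rV_bigcup.

End measurable_rV.

Definition argmin (T : Type) (disp : Order.disp_t) (U : porderType disp)
    (S : set T) (f : T -> U) : set T :=
  [set y | S y /\ forall z, S z -> (f y <= f z)%O].

Definition is_max (R : realType) (S : set R) (m : R) : Prop :=
  S m /\ ubound S m.

(* Projection and proximal operator: an element of the argmin, and the junk
   value 0 when there is none. *)
Definition proj_set (R : realType) (d : nat) (S : set 'rV[R]_d) (x : 'rV[R]_d) :
    'rV[R]_d :=
  xget 0 (argmin S (fun y => enorm (y - x))).

Definition prox (R : realType) (d : nat) (gamma : R) (r : 'rV[R]_d -> \bar R)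
    (x : 'rV[R]_d) : 'rV[R]_d :=
  xget 0 (argmin setT
    (fun y => (r y + (enorm (y - x) ^+ 2 / (2 * gamma))%:E)%E)).

(* Regularizers take values in \bar R, with +oo outside of their domain. *)
Definition proper_ereal (R : realType) (T : Type) (r : T -> \bar R) : Prop :=
  (forall x, (-oo < r x)%E) /\ exists x, (r x < +oo)%E.

Definition convex_ereal (R : realType) (d : nat) (r : 'rV[R]_d -> \bar R) :
    Prop :=
  forall (x y : 'rV[R]_d) (t : R), 0 <= t -> t <= 1 ->
    (r (t *: x + (1 - t) *: y)%R <= t%:E * r x + (1 - t)%:E * r y)%E.

(* Solutions of the regularized variational inequality. For a proper r they all
   lie in the domain of r: if r xs = +oo, then the right-hand side is -oo at
   any point where r is finite. *)
Definition VI_solutions (R : realType) (d : nat) (F : 'rV[R]_d -> 'rV[R]_d)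
    (r : 'rV[R]_d -> \bar R) : set 'rV[R]_d :=
  [set xs | forall x, (0 <= (inner (F xs) (x - xs))%:E + r x - r xs)%E].

Definition star_cocoercive (R : realType) (d : nat) (F : 'rV[R]_d -> 'rV[R]_d)
    (Xs : set 'rV[R]_d) (l : R) : Prop :=
  forall x, let xs := proj_set Xs x in
    enorm (F x - F xs) ^+ 2 <= l * inner (F x - F xs) (x - xs).

Definition average (R : realType) (d n : nat) (v : 'I_n -> 'rV[R]_d) :
    'rV[R]_d :=
  n%:R^-1 *: \sum_(i < n) v i.

(* The random vector X has expectation v; in particular it is integrable. *)
Definition has_mean (R : realType) (d : nat) (disp : measure_display)
    (T : measurableType disp) (P : probability T R) (X : T -> 'rV[R]_d)
    (v : 'rV[R]_d) : Prop :=
  forall j : 'I_d, P.-integrable setT (fun t => (X t ord0 j)%:E) /\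
                   'E_P[fun t => X t ord0 j]%E = (v ord0 j)%:E.

(* Mutual independence of a finite family of sub-sigma-algebras. *)
Definition mutually_independent (R : realType) (disp : measure_display)
    (T : measurableType disp) (P : probability T R) (I : finType)
    (G : I -> set (set T)) : Prop :=
  forall (J : {set I}) (E : I -> set T), (forall i, i \in J -> G i (E i)) ->
    P (\bigcap_(i in [set` J]) E i) = (\prod_(i in J) P (E i))%E.

(* A randomized operator is a map x |-> Q s x that depends on a random seed s
   of law nu. *)
Definition unbiased_compressor (R : realType) (d : nat)
    (disp : measure_display) (S : measurableType disp) (nu : probability S R)
    (Q : S -> 'rV[R]_d -> 'rV[R]_d) (omega : R) : Prop :=
  [/\ 0 <= omega,
      measurable_fun setT (fun p : S * 'rV[R]_d => Q p.1 p.2),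
      forall x, has_mean nu (fun s => Q s x) x &
      forall x, ('E_nu[fun s => (enorm (Q s x - x) ^+ 2)%R] <=
                 (omega * enorm x ^+ 2)%:E)%E].

(* A run is a sequence w : nat -> Om, where w k is the randomness drawn at
   iteration k, with law P k, independently of the other iterations. The
   quantities of the algorithm are functions of the run. The expectation E_k
   integrates the randomness w k of iteration k, the past being fixed. *)
Definition resample (Om : Type) (w : nat -> Om) (k : nat) (s : Om) :
    nat -> Om :=
  [eta w with k |-> s].

Definition E_iter (R : realType) (disp : measure_display)
    (Om : measurableType disp) (P : nat -> probability Om R) (k : nat)
    (Z : (nat -> Om) -> R) (w : nat -> Om) : \bar R :=
  ('E_(P k)[fun s => Z (resample w k s)])%E.

Definition E_iter_vec (R : realType) (d : nat) (disp : measure_display)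
    (Om : measurableType disp) (P : nat -> probability Om R) (k : nat)
    (Z : (nat -> Om) -> 'rV[R]_d) (w : nat -> Om) (v : 'rV[R]_d) : Prop :=
  has_mean (P k) (fun s => Z (resample w k s)) v.

(* Z only depends on the randomness of the iterations 0, ..., k - 1. *)
Definition known_before (Om U : Type) (k : nat) (Z : (nat -> Om) -> U) : Prop :=
  forall w w' : nat -> Om, (forall m, (m < k)%N -> w m = w' m) -> Z w = Z w'.

(* QSGDA: g k i is the estimator g_i^k computed by worker i at iteration k, and
   xi k i (w k) is the seed that worker i uses to quantize it. *)
Definition qsgda_g (R : realType) (d n : nat) (Om S : Type)
    (Q : S -> 'rV[R]_d -> 'rV[R]_d) (xi : nat -> 'I_n -> Om -> S)
    (g : nat -> 'I_n -> (nat -> Om) -> 'rV[R]_d) (k : nat) (w : nat -> Om) :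
    'rV[R]_d :=
  average (fun i => Q (xi k i (w k)) (g k i w)).

Fixpoint qsgda_x (R : realType) (d n : nat) (Om S : Type)
    (r : 'rV[R]_d -> \bar R) (gamma : R) (x0 : 'rV[R]_d)
    (Q : S -> 'rV[R]_d -> 'rV[R]_d) (xi : nat -> 'I_n -> Om -> S)
    (g : nat -> 'I_n -> (nat -> Om) -> 'rV[R]_d) (k : nat) (w : nat -> Om) :
    'rV[R]_d :=
  if k is m.+1 then
    prox gamma r (qsgda_x r gamma x0 Q xi g m w - gamma *: qsgda_g Q xi g m w)
  else x0.

(* At iteration k, given the past, the estimators of the n workers and their
   quantization seeds are 2n mutually independent random elements, and each
   seed has law nu. *)
Definition independent_workers (R : realType) (d n : nat)
    (disp disp' : measure_display) (Om : measurableType disp)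
    (S : measurableType disp') (P : nat -> probability Om R)
    (nu : probability S R) (xi : nat -> 'I_n -> Om -> S)
    (g : nat -> 'I_n -> (nat -> Om) -> 'rV[R]_d) : Prop :=
  [/\ forall k i, measurable_fun setT (xi k i),
      forall k i (A : set S), measurable A -> P k (xi k i @^-1` A) = nu A &
      forall k (w : nat -> Om),
        mutually_independent (P k) (fun a : 'I_n + 'I_n =>
          match a with
          | inl i => g_sigma_algebra_preimage (fun s => g k i (resample w k s))
          | inr i => g_sigma_algebra_preimage (xi k i)
          end)].

Record key_assumption (R : realType) (d : nat) (disp : measure_display)
    (Om : measurableType disp) (P : nat -> probability Om R)
    (F : 'rV[R]_d -> 'rV[R]_d) (Xs : set 'rV[R]_d)
    (x g : nat -> (nat -> Om) -> 'rV[R]_d) (sig : nat -> (nat -> Om) -> R)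
    (A B C D1 D2 rho : R) : Prop := KeyAssumption {
  key_nonneg : [/\ 0 <= A, 0 <= B, 0 <= C, 0 <= D1 & 0 <= D2];
  key_rho : 0 < rho /\ rho <= 1;
  key_sig : forall k, [/\ forall w, 0 <= sig k w, known_before k (sig k) &
    forall w, measurable_fun setT (fun s => sig k.+1 (resample w k s))];
  key_unbiased : forall k w, E_iter_vec P k (g k) w (F (x k w));
  key_second_moment : forall k w,
    (E_iter P k (fun w' => (enorm (g k w' - F (proj_set Xs (x k w'))) ^+ 2)%R) w <=
     (2 * A * inner (F (x k w) - F (proj_set Xs (x k w)))
                    (x k w - proj_set Xs (x k w)) +
      B * sig k w ^+ 2 + D1)%:E)%E;
  key_sig_recursion : forall k w,
    (E_iter P k (fun w' => (sig k.+1 w' ^+ 2)%R) w <=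
     (2 * C * inner (F (x k w) - F (proj_set Xs (x k w)))
                    (x k w - proj_set Xs (x k w)) +
      (1 - rho) * sig k w ^+ 2 + D2)%:E)%E
}.

(* Main.v *)
Require Import Defs.
From HB Require Import structures.
From mathcomp Require Import all_boot all_order all_algebra.
From mathcomp Require Import all_classical all_reals all_analysis.
From mathcomp Require Import measurable_realfun lra.
Set Implicit Arguments.
Unset Strict Implicit.
Unset Printing Implicit Defensive.
Import Order.TTheory GRing.Theory Num.Theory.
Import numFieldNormedType.Exports.
Local Open Scope classical_set_scope.
Local Open Scope ring_scope.

(** Given the past, the pairs (quantization seed, estimator) of the workers are
    pairwise independent, so the cross terms of the centred average vanish and
    [E |g - c|^2 = |F x - c|^2 + n^-2 sum_i E |Q(g_i) - F_i x|^2].  Inside a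
    worker, the seed is independent of the estimator and Fubini gives
    [E |Q(g_i) - g_i|^2 <= omega E |g_i|^2].  The constants of the statement
    leave enough room to split all the remaining squares with
    [|a + b|^2 <= 2 |a|^2 + 2 |b|^2]. *)

(** * Independence of random elements, joint laws and covariance *)

Section independence.
Local Open Scope ereal_scope.
Context {R : realType} {d : measure_display} {T : measurableType d}.
Variable P : probability T R.

Definition independent2 {d1 d2} {T1 : measurableType d1}
    {T2 : measurableType d2} (U : T -> T1) (V : T -> T2) : Prop :=
  forall A B, measurable A -> measurable B ->
    P (U @^-1` A `&` V @^-1` B) = P (U @^-1` A) * P (V @^-1` B).

Lemma independent2_comp {d1 d2 d3 d4} {T1 : measurableType d1}
    {T2 : measurableType d2} {T3 : measurableType d3} {T4 : measurableType d4}
    (U : T -> T1) (V : T -> T2) (f : T1 -> T3) (h : T2 -> T4) :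
  measurable_fun setT f -> measurable_fun setT h ->
  independent2 U V -> independent2 (f \o U) (h \o V).
Proof.
move=> mf mh UV A B mA mB.
apply: (UV (f @^-1` A) (h @^-1` B)).
- by rewrite -[X in measurable X]setTI; exact: mf.
- by rewrite -[X in measurable X]setTI; exact: mh.
Qed.

(** Both sides, as functions of [X], are finite measures on the product: the image under [(U, V)] of
    [P] restricted to [E], and the law of [(U, V)] scaled by [P E]. They agree on rectangles, a
    generating family stable under intersection, hence everywhere. *)
Lemma independent_event_pair {d1 d2} {T1 : measurableType d1}
    {T2 : measurableType d2} (U : T -> T1) (V : T -> T2) (E : set T) :
  measurable_fun setT U -> measurable_fun setT V -> measurable E ->
  (forall A B, measurable A -> measurable B ->
    P ((U @^-1` A `&` V @^-1` B) `&` E) = P (U @^-1` A `&` V @^-1` B) * P E) ->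
  forall X, measurable X ->
  P ((fun t => (U t, V t)) @^-1` X `&` E) =
  P ((fun t => (U t, V t)) @^-1` X) * P E.
Proof.
move=> mU mV mE UVE X mX.
have mUV : measurable_fun setT (fun t => (U t, V t)).
  exact: measurable_fun_pair.
pose UV : {mfun T >-> (T1 * T2)%type} :=
  HB.pack (fun t => (U t, V t)) (isMeasurableFun.Build _ _ _ _ _ mUV).
(* [mscale] takes a nonnegative real factor, so the finite value [P E] is converted. *)
pose c : {nonneg R} := NngNum (fine_ge0 (measure_ge0 P E)).
have cE : c%:num%:E = P E by rewrite /= fineK// fin_num_measure.
pose G := [set A `*` B | A in @measurable _ T1 & B in @measurable _ T2].
have := @measure_unique _ R (T1 * T2)%type G (fun=> setT) _ _ _ _
  (pushforward (mrestr P mE) UV) (mscale c (pushforward P UV)) _ _ X mX.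
rewrite /= /pushforward /mrestr /mscale/= cE muleC; apply.
- exact: measurable_prod_measurableType.
- move=> _ _ [A1 mA1 [B1 mB1 <-]] [A2 mA2 [B2 mB2 <-]].
  rewrite -setXI; exists (A1 `&` A2); first exact: measurableI.
  by exists (B1 `&` B2) => //; exact: measurableI.
- by move=> _; exists setT => //; exists setT => //; rewrite setXTT.
- by rewrite bigcup_const.
- exact: mUV.
- exact: mUV.
- by move=> _ [A mA [B mB <-]]; rewrite muleC -UVE.
- by move=> _; rewrite preimage_setT setTI ltey_eq fin_num_measure.
Qed.

(** Rectangles give way to arbitrary events one pair at a time: [independent_event_pair] serves for
    [(U', V')] against a fixed rectangle event of [(U, V)], and for [(U, V)] against an arbitrary
    event of [(U', V')]. *)
Lemma independent2_pairs {d1 d2 d3 d4} {T1 : measurableType d1}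
    {T2 : measurableType d2} {T3 : measurableType d3} {T4 : measurableType d4}
    (U : T -> T1) (V : T -> T2) (U' : T -> T3) (V' : T -> T4) :
  measurable_fun setT U -> measurable_fun setT V ->
  measurable_fun setT U' -> measurable_fun setT V' ->
  (forall A B A' B',
    measurable A -> measurable B -> measurable A' -> measurable B' ->
    P ((U @^-1` A `&` V @^-1` B) `&` (U' @^-1` A' `&` V' @^-1` B')) =
    P (U @^-1` A `&` V @^-1` B) * P (U' @^-1` A' `&` V' @^-1` B')) ->
  independent2 (fun t => (U t, V t)) (fun t => (U' t, V' t)).
Proof.
move=> mU mV mU' mV' indep X Y mX mY.
have mI d5 d6 (T5 : measurableType d5) (T6 : measurableType d6)
    (f : T -> T5) (h : T -> T6) A B : measurable_fun setT f ->
    measurable_fun setT h -> measurable A -> measurable B ->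
    measurable (f @^-1` A `&` h @^-1` B).
  by move=> mf mh mA mB; apply: measurableI;
    rewrite -[X in measurable X]setTI; [exact: mf|exact: mh].
apply: independent_event_pair => //.
  rewrite -[X in measurable X]setTI.
  by apply: (measurable_fun_pair mU' mV').
move=> A B mA mB; rewrite setIC muleC.
apply: independent_event_pair => //; first exact: mI.
by move=> A' B' mA' mB'; rewrite setIC muleC indep.
Qed.

Section law_of_pair.
Context {d1 d2 : measure_display} {T1 : measurableType d1}
  {T2 : measurableType d2}.
Variables (U : {mfun T >-> T1}) (V : {mfun T >-> T2}) (nu : probability T1 R).
Hypothesis UV : independent2 U V.
Hypothesis Unu : forall A, measurable A -> P (U @^-1` A) = nu A.

Let mpair : measurable_fun setT (fun t => (U t, V t)).
Proof. exact: measurable_fun_pair. Qed.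

Let pair : {mfun T >-> (T1 * T2)%type} :=
  HB.pack (fun t => (U t, V t)) (isMeasurableFun.Build _ _ _ _ _ mpair).

Let law_pair X : measurable X ->
  (nu \x distribution P V) X = distribution P pair X.
Proof.
apply: product_measure_unique => A B mA mB.
by have := UV mA mB; rewrite Unu.
Qed.

Let ge0_integral_law_pair (f : T1 * T2 -> \bar R) :
  measurable_fun setT f -> (forall p, 0 <= f p) ->
  \int[nu \x distribution P V]_p f p = \int[P]_t f (U t, V t).
Proof.
move=> mf f0; rewrite (eq_measure_integral (distribution P pair)); last first.
  by move=> A mA _; exact: law_pair.
by rewrite ge0_integral_distribution.
Qed.

(** Tonelli under the joint law, which independence makes a product: the value of [V] is frozen
    while [U] is averaged out under its law [nu]. *)
Lemma ge0_integral_independent2 (f : T1 * T2 -> \bar R) :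
  measurable_fun setT f -> (forall p, 0 <= f p) ->
  \int[P]_t f (U t, V t) = \int[P]_t \int[nu]_u f (u, V t).
Proof.
move=> mf f0; rewrite -ge0_integral_law_pair// fubini_tonelli2//.
rewrite ge0_integral_distribution//.
- exact: measurable_fun_fubini_tonelli_G.
- by move=> v; apply: integral_ge0.
Qed.

(** Fubini under the joint law, for signed [f]. The outer integral stays under the law of [V], so
    that the inner one can be computed before returning to [P]. *)
Lemma integral_independent2 (f : T1 * T2 -> \bar R) :
  measurable_fun setT f -> P.-integrable setT (fun t => f (U t, V t)) ->
  \int[P]_t f (U t, V t) = \int[distribution P V]_v \int[nu]_u f (u, v).
Proof.
move=> mf intf.
(* Integrability passes to the product measure through the nonnegative case applied to the absolute
   value of [f]. *)
have intf' : (nu \x distribution P V).-integrable setT f.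
  apply/integrableP; split => //.
  rewrite (ge0_integral_law_pair (f := abse \o f)).
  - by case/integrableP: intf.
  - exact: measurableT_comp.
  - by move=> p; exact: abse_ge0.
rewrite (integral21_prod_meas1 intf').
rewrite (eq_measure_integral (distribution P pair)); last first.
  by move=> A mA _; exact: law_pair.
by rewrite integral_distribution.
Qed.

End law_of_pair.

(** Fubini gives [E[YZ] = E[Y] E[Z]]; square integrability makes the product integrable. *)
Lemma independent2_covariance (Y Z : T -> R) :
  Y \in Lfun P 2%:E -> Z \in Lfun P 2%:E -> independent2 Y Z ->
  covariance P Y Z = 0.
Proof.
move=> Y2 Z2 YZ.
have Pfin : P setT \is a fin_num := fin_num_measure P _ measurableT.
have Y1 := Lfun_subset12 Pfin Y2.
have Z1 := Lfun_subset12 Pfin Z2.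
have YZ1 := Lfun2_mul_Lfun1 Y2 Z2.
have iY : P.-integrable setT (EFin \o Y) by exact/Lfun1_integrable.
have iZ : P.-integrable setT (EFin \o Z) by exact/Lfun1_integrable.
have mY : measurable_fun setT Y by move/measurable_int/measurable_EFinP : iY.
have mZ : measurable_fun setT Z by move/measurable_int/measurable_EFinP : iZ.
pose Y' : {mfun T >-> R} := HB.pack Y (isMeasurableFun.Build _ _ _ _ _ mY).
pose Z' : {mfun T >-> R} := HB.pack Z (isMeasurableFun.Build _ _ _ _ _ mZ).
rewrite covarianceE//; apply/eqP; rewrite sube_eq ?add0e; last 2 first.
- by rewrite expectation_fin_num.
- by rewrite fin_num_adde_defl// fin_numM ?expectation_fin_num.
apply/eqP; rewrite [in LHS]unlock.
transitivity (\int[distribution P Z']_z \int[distribution P Y']_y (y * z)%:E).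
  apply: (integral_independent2 (U := Y') (V := Z') (nu := distribution P Y')
    _ _ (f := fun p : R * R => (p.1 * p.2)%:E)) => //;
    last exact/Lfun1_integrable.
  by apply/measurable_EFinP; exact: measurable_funM.
transitivity (\int[distribution P Z']_z ('E_P[Y] * z%:E)).
  apply: eq_integral => z _ /=.
  under eq_integral do rewrite EFinM.
  rewrite integralZr//.
    congr (_ * _); rewrite unlock.
    rewrite integral_distribution//.
  apply: integrable_pushforward => //.
rewrite -(fineK (expectation_fin_num Y1)) integral_distribution//.
- rewrite /= integralZl//; congr (_ * _).
  by rewrite unlock.
- exact: emeasurable_funM.
- exact: (integrableZl measurableT _ iZ).
Qed.

End independence.

(** * Second moments of real random variables and of their averages *)

Section second_moments.
Local Open Scope ereal_scope.
Context {R : realType} {d : measure_display} {T : measurableType d}.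
Variable P : probability T R.

Let Pfin : P setT \is a fin_num := fin_num_measure P _ measurableT.

Lemma Lfun2_sqr (X : T -> R) : measurable_fun setT X ->
  'E_P[fun t => (X t ^+ 2)%R] < +oo -> X \in Lfun P 2%:E.
Proof.
move=> mX; rewrite unlock => X2.
rewrite inE; apply/andP; split; first by rewrite inE.
rewrite inE /finite_norm unlock /= poweR_lty//.
rewrite (eq_integral (fun t => (X t ^+ 2)%:E))// => t _.
by rewrite powR_mulrn// real_normK ?num_real.
Qed.

(** Bias-variance decomposition: shifting by [c] leaves the variance unchanged and moves the mean to
    [m - c]. *)
Lemma expectation_sqr_sub (X : T -> R) (m c : R) :
  X \in Lfun P 2%:E -> 'E_P[X] = m%:E ->
  'E_P[fun t => ((X t - c) ^+ 2)%R] = 'V_P[X] + ((m - c) ^+ 2)%:E.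
Proof.
move=> X2 Xm; have X1 := Lfun_subset12 Pfin X2.
have Xc2 : (X \- cst c)%R \in Lfun P 2%:E.
  by rewrite rpredB ?lee1n//= => _; exact: Lfun_cst.
rewrite -(varianceB_cst_r c X2) varianceE// expectationB ?Lfun_cst//.
by rewrite expectation_cst Xm -EFinB -EFin_expe subeK.
Qed.

Lemma covariance_sumr (I : Type) (X : T -> R) (Z : I -> T -> R) (s : seq I) :
  X \in Lfun P 2%:E -> (forall i, Z i \in Lfun P 2%:E) ->
  covariance P X (\sum_(i <- s) Z i)%R = \sum_(i <- s) covariance P X (Z i).
Proof.
move=> X2 Z2; elim: s => [|i s IHs].
  by rewrite !big_nil covariance_cst_r.
rewrite !big_cons covarianceDr ?IHs//.
by rewrite rpred_sum ?lee1n//.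
Qed.

(** Induction on the list: [uniq] makes the head differ from every index of the tail, so the
    covariance of the head with the tail sum vanishes. *)
Lemma variance_sum_uncorrelated (I : eqType) (Z : I -> T -> R) (s : seq I) :
  uniq s -> (forall i, Z i \in Lfun P 2%:E) ->
  (forall i k, i != k -> covariance P (Z i) (Z k) = 0) ->
  'V_P[(\sum_(i <- s) Z i)%R] = \sum_(i <- s) 'V_P[Z i].
Proof.
move=> + Z2 Z0; elim: s => [|i s IHs] /=.
  by rewrite !big_nil variance_cst.
move=> /andP[nis us]; rewrite !big_cons varianceD//; last first.
  by rewrite rpred_sum ?lee1n//.
rewrite IHs// covariance_sumr//.
rewrite (_ : \sum_(k <- s) covariance P (Z i) (Z k) = 0) ?mule0 ?adde0//.
rewrite big_seq big1// => k ks; rewrite Z0//.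
by apply: contraNneq nis => ->.
Qed.

Lemma expectation_sum_ord {n : nat} (Z : 'I_n -> T -> R) (m : 'I_n -> R) :
  (forall i, Z i \in Lfun P 1) -> (forall i, 'E_P[Z i] = (m i)%:E) ->
  'E_P[(\sum_i Z i)%R] = (\sum_(i < n) m i)%:E.
Proof.
move=> Z1 Zm; have /= := @expectation_sum _ _ _ P [seq Z i | i : 'I_n] _.
rewrite !big_map -!big_enum/= => ->.
  by rewrite -sumEFin; apply: eq_bigr => i _; exact: Zm.
by move=> _ /mapP[i _ ->].
Qed.

(** Bias-variance decomposition of an average, whose variance is [n^-2] times the sum of the
    variances. It is the one-coordinate form of the identity for the workers. *)
Lemma expectation_sqr_mean_sub (n : nat) (Z : 'I_n -> T -> R) (m : 'I_n -> R)
    (c : R) : (forall i, Z i \in Lfun P 2%:E) ->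
  (forall i, 'E_P[Z i] = (m i)%:E) ->
  (forall i k, i != k -> covariance P (Z i) (Z k) = 0) ->
  'E_P[fun t => ((n%:R^-1 * \sum_(i < n) Z i t - c) ^+ 2)%R] =
  ((n%:R^-1 * \sum_(i < n) m i - c) ^+ 2)%:E +
  (n%:R^-1 ^+ 2)%:E * \sum_(i < n) 'E_P[fun t => ((Z i t - m i) ^+ 2)%R].
Proof.
move=> Z2 Zm Z0.
have Z1 i : Z i \in Lfun P 1 by exact: Lfun_subset12.
have W2 : (\sum_i Z i)%R \in Lfun P 2%:E by rewrite rpred_sum ?lee1n//.
have W1 := Lfun_subset12 Pfin W2.
have WE := expectation_sum_ord Z1 Zm.
transitivity ('E_P[fun t => (((n%:R^-1 \o* \sum_i Z i) t - c) ^+ 2)%R]).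
  by congr expectation; apply/funext => t /=; rewrite fct_sumE mulrC.
rewrite (@expectation_sqr_sub _ (n%:R^-1 * \sum_(i < n) m i)%R).
- rewrite addeC; congr (_ + _).
  rewrite varianceZ// variance_sum_uncorrelated ?index_enum_uniq//.
  congr (_ * _); apply: eq_bigr => i _.
  (* Centred at its own mean, [Z i] has no bias term, so its variance is its centred second
     moment. *)
  by rewrite (expectation_sqr_sub (m i) (Z2 i) (Zm i)) subrr expr0n/= adde0.
- by rewrite Lfun_scale// ler1n.
- by rewrite expectationZl// WE EFinM.
Qed.

End second_moments.

(** * Squared Euclidean norms *)

Section euclidean.
Context {R : realType} {n : nat}.
Implicit Types u v : 'rV[R]_n.

Lemma enorm_sqr u : enorm u ^+ 2 = \sum_(j < n) u ord0 j ^+ 2.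
Proof.
rewrite /enorm /inner sqr_sqrtr; first by apply: eq_bigr => j _; rewrite expr2.
by apply: sumr_ge0 => j _; rewrite -expr2 sqr_ge0.
Qed.

Lemma enorm_sqrD_le u v :
  enorm (u + v) ^+ 2 <= 2 * enorm u ^+ 2 + 2 * enorm v ^+ 2.
Proof.
rewrite !enorm_sqr !mulr_sumr -big_split/=; apply: ler_sum => j _.
(* In each coordinate the gap between the two sides is exactly this square. *)
by rewrite mxE; have := sqr_ge0 (u ord0 j - v ord0 j); nra.
Qed.

Lemma coord_sqr_le_enorm u j : u ord0 j ^+ 2 <= enorm u ^+ 2.
Proof.
rewrite enorm_sqr (bigD1 j)//= lerDl.
by apply: sumr_ge0 => k _; exact: sqr_ge0.
Qed.

End euclidean.

(** * Measurability of maps into row vectors *)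

Section measurable_rV_theory.
Context {d d' : measure_display} {T : measurableType d}
  {T' : measurableType d'}.
Variable n : nat.

Lemma measurable_coord (j : 'I_n) :
  measurable_fun setT (fun v : 'rV[T]_n => v ord0 j).
Proof.
move=> _ Y mY; rewrite setTI; apply: sub_sigma_algebra => /=.
rewrite -bigcup_seq/=; exists j => /=; first by rewrite mem_index_enum.
by exists Y => //; rewrite setTI.
Qed.

(** The sigma-algebra is generated by the preimages under the coordinates, so it is enough to test
    those. *)
Lemma measurable_fun_rV (f : T' -> 'rV[T]_n) :
  (forall j, measurable_fun setT (fun t => f t ord0 j)) ->
  measurable_fun setT f.
Proof.
move=> mf; apply: (@measurability _ _ _ _ _ _
  (\big[setU/set0]_(j < n) preimage_set_system setT
     (fun v : 'rV[T]_n => v ord0 j) measurable)) => //.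
move=> _ [A + <-]; rewrite -bigcup_seq => -[j _ [B mB <-]].
by rewrite !setTI; have := mf j measurableT B mB; rewrite setTI.
Qed.

End measurable_rV_theory.

(** * Means and second moments of random vectors *)

Section random_vectors.
Local Open Scope ereal_scope.
Context {R : realType} {dT : measure_display} {T : measurableType dT}.
Variables (P : probability T R) (d : nat).
Implicit Types W : T -> 'rV[R]_d.

Lemma measurable_fun_coord {dT'} {T' : measurableType dT'}
    (W : T' -> 'rV[R]_d) (j : 'I_d) :
  measurable_fun setT W -> measurable_fun setT (fun t => W t ord0 j).
Proof. by move=> mW; apply: (measurableT_comp (measurable_coord j)). Qed.

(** This is how the estimators get their measurability: a mean presupposes integrable, hence
    measurable, coordinates. *)
Lemma has_mean_measurable W v : has_mean P W v -> measurable_fun setT W.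
Proof.
move=> Wv; apply: measurable_fun_rV => j.
by have [/measurable_int/measurable_EFinP] := Wv j.
Qed.

Lemma measurable_fun_rVD {dT'} {T' : measurableType dT'}
    (W V : T' -> 'rV[R]_d) :
  measurable_fun setT W -> measurable_fun setT V ->
  measurable_fun setT (fun t => W t + V t)%R.
Proof.
move=> mW mV; apply: measurable_fun_rV => j.
under eq_fun do rewrite mxE.
by apply: measurable_funD; exact: measurable_fun_coord.
Qed.

Lemma measurable_fun_rVB {dT'} {T' : measurableType dT'}
    (W V : T' -> 'rV[R]_d) :
  measurable_fun setT W -> measurable_fun setT V ->
  measurable_fun setT (fun t => W t - V t)%R.
Proof.
move=> mW mV; apply: measurable_fun_rV => j.
under eq_fun do rewrite !mxE.
by apply: measurable_funB; exact: measurable_fun_coord.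
Qed.

Lemma measurable_enorm_sqr {dT'} {T' : measurableType dT'}
    (W : T' -> 'rV[R]_d) :
  measurable_fun setT W -> measurable_fun setT (fun t => (enorm (W t) ^+ 2)%R).
Proof.
move=> mW; under eq_fun do rewrite enorm_sqr.
apply: measurable_sum => j; apply: measurable_funX.
exact: measurable_fun_coord.
Qed.

Lemma expectation_enorm_sqr W : measurable_fun setT W ->
  'E_P[fun t => (enorm (W t) ^+ 2)%R] =
  \sum_(j < d) 'E_P[fun t => (W t ord0 j ^+ 2)%R].
Proof.
move=> mW; rewrite unlock.
under eq_integral do rewrite enorm_sqr -sumEFin.
rewrite ge0_integral_sum//.
- move=> j; apply/measurable_EFinP; apply: measurable_funX.
  exact: measurable_fun_coord.
- by move=> j t _; rewrite lee_fin sqr_ge0.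
Qed.

(** A coordinate of [W - m] is dominated by the norm, so it is square integrable; adding back the
    constant [m ord0 j] preserves this. *)
Lemma Lfun2_coord W (m : 'rV[R]_d) (j : 'I_d) : measurable_fun setT W ->
  'E_P[fun t => (enorm (W t - m) ^+ 2)%R] < +oo ->
  (fun t => W t ord0 j) \in Lfun P 2%:E.
Proof.
move=> mW Woo.
have mWm : measurable_fun setT (fun t => W t - m)%R.
  by apply: measurable_fun_rVB => //; exact: measurable_cst.
have mWmj := measurable_fun_coord j mWm.
have Wm2 : (fun t => (W t - m)%R ord0 j) \in Lfun P 2%:E.
  apply: Lfun2_sqr => //; apply: le_lt_trans Woo; apply: expectation_le.
  - exact: measurable_funX.
  - exact: measurable_enorm_sqr.
  - by move=> t; exact: sqr_ge0.
  - by move=> t; exact: sqr_ge0.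
  - by apply/aeW => t; exact: coord_sqr_le_enorm.
have -> : (fun t => W t ord0 j) =
    ((fun t => (W t - m)%R ord0 j) \+ cst (m ord0 j))%R.
  by apply/funext => t /=; rewrite !mxE subrK.
by rewrite rpredD ?lee1n//= => _; exact: Lfun_cst.
Qed.

Lemma has_mean_average (n : nat) (W : 'I_n -> T -> 'rV[R]_d)
    (m : 'I_n -> 'rV[R]_d) : (forall i, has_mean P (W i) (m i)) ->
  has_mean P (fun t => average (W ^~ t)) (average m).
Proof.
move=> Wm j.
have W1 i : (fun t => W i t ord0 j) \in Lfun P 1.
  by apply/Lfun1_integrable; have [] := Wm i j.
have sW1 : (\sum_(i < n) (fun t => W i t ord0 j))%R \in Lfun P 1.
  by rewrite rpred_sum.
have averageE : (fun t => average (W ^~ t) ord0 j) =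
    (n%:R^-1 \o* \sum_(i < n) (fun t => W i t ord0 j))%R.
  by apply/funext => t; rewrite /average !mxE summxE /= fct_sumE mulrC.
split.
  rewrite -/(EFin \o (fun t => average (W ^~ t) ord0 j)) averageE.
  by apply/Lfun1_integrable; rewrite Lfun_scale.
rewrite averageE expectationZl//.
rewrite (expectation_sum_ord (m := fun i => m i ord0 j))//.
  by rewrite /average !mxE summxE EFinM.
by move=> i; have [] := Wm i j.
Qed.

(** The squared norm is a sum over coordinates, and [expectation_sqr_mean_sub] handles each of them.
    Independence of distinct [W i] cancels the cross terms. *)
Lemma expectation_enorm_average_sub (n : nat) (W : 'I_n -> T -> 'rV[R]_d)
    (m : 'I_n -> 'rV[R]_d) (c : 'rV[R]_d) :
  (forall i, has_mean P (W i) (m i)) ->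
  (forall i, 'E_P[fun t => (enorm (W i t - m i) ^+ 2)%R] < +oo) ->
  (forall i k, i != k -> independent2 P (W i) (W k)) ->
  'E_P[fun t => (enorm (average (W ^~ t) - c) ^+ 2)%R] =
  (enorm (average m - c) ^+ 2)%:E +
  (n%:R^-1 ^+ 2)%:E *
    \sum_(i < n) 'E_P[fun t => (enorm (W i t - m i) ^+ 2)%R].
Proof.
move=> Wm Woo Windep.
have mW i := has_mean_measurable (Wm i).
have mWm i : measurable_fun setT (fun t => W i t - m i)%R.
  by apply: measurable_fun_rVB => //; exact: measurable_cst.
have W2 i j : (fun t => W i t ord0 j) \in Lfun P 2%:E.
  exact: (Lfun2_coord j (mW i) (Woo i)).
have averageE (w : 'I_n -> 'rV[R]_d) j :
    ((average w - c)%R ord0 j =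
     n%:R^-1 * (\sum_(i < n) w i ord0 j) - c ord0 j)%R.
  by rewrite /average !mxE summxE.
have mA : measurable_fun setT (fun t => average (W ^~ t) - c)%R.
  apply: measurable_fun_rV => j; under eq_fun do rewrite averageE.
  apply: measurable_funB; last exact: measurable_cst.
  apply: measurable_funM; first exact: measurable_cst.
  by apply: measurable_sum => i; exact: measurable_fun_coord.
rewrite (eq_bigr _ (fun i _ => expectation_enorm_sqr (mWm i))).
rewrite expectation_enorm_sqr// enorm_sqr -sumEFin exchange_big/=.
(* Distributing the factor over a sum of extended reals relies on the terms being nonnegative. *)
rewrite ge0_sume_distrr; last first.
  move=> j _; apply: sume_ge0 => i _; apply: expectation_ge0 => t.
  exact: sqr_ge0.
rewrite -big_split/=; apply: eq_bigr => j _.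
under [in LHS]eq_fun do rewrite averageE.
rewrite (expectation_sqr_mean_sub (Z := fun i t => W i t ord0 j)
  (m := fun i => m i ord0 j))//.
- rewrite averageE; congr (_ + _ * _); apply: eq_bigr => i _.
  by congr expectation; apply/funext => t; rewrite !mxE.
- by move=> i; have [] := Wm i j.
- move=> i k ik; apply: independent2_covariance => //.
  exact: (independent2_comp (measurable_coord j) (measurable_coord j)
    (Windep i k ik)).
Qed.

Lemma expectation_enorm_sqrD_le (V W : T -> 'rV[R]_d) :
  measurable_fun setT V -> measurable_fun setT W ->
  'E_P[fun t => (enorm (V t + W t) ^+ 2)%R] <=
  2%:E * 'E_P[fun t => (enorm (V t) ^+ 2)%R] +
  2%:E * 'E_P[fun t => (enorm (W t) ^+ 2)%R].
Proof.
move=> mV mW; rewrite unlock.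
have mV2 := measurable_enorm_sqr mV.
have mW2 := measurable_enorm_sqr mW.
have ge0 (U : T -> 'rV[R]_d) t : 0 <= (enorm (U t) ^+ 2)%:E.
  by rewrite lee_fin sqr_ge0.
rewrite -!ge0_integralZl_EFin//; try exact/measurable_EFinP.
rewrite -ge0_integralD//.
- apply: ge0_le_integral => //.
  + by move=> t _; exact: (ge0 (fun t => V t + W t)%R).
  + apply/measurable_EFinP; apply: measurable_enorm_sqr.
    exact: measurable_fun_rVD.
  + by apply: emeasurable_funD; apply: measurable_funeM; exact/measurable_EFinP.
  + by move=> t _; rewrite -!EFinM -EFinD lee_fin; exact: enorm_sqrD_le.
- by move=> t _; rewrite mule_ge0.
- by apply: measurable_funeM; exact/measurable_EFinP.
- by move=> t _; rewrite mule_ge0.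
- by apply: measurable_funeM; exact/measurable_EFinP.
Qed.

End random_vectors.

(** * One worker: mean and error of a quantized estimator *)

Section quantization.
Local Open Scope ereal_scope.
Context {R : realType} {dT dS : measure_display} {T : measurableType dT}
  {S : measurableType dS}.
Variables (P : probability T R) (d : nat) (nu : probability S R).
Variables (Q : S -> 'rV[R]_d -> 'rV[R]_d) (omega : R).
Hypothesis hQ : unbiased_compressor nu Q omega.
Variables (X : T -> S) (G : T -> 'rV[R]_d) (v : 'rV[R]_d) (s : R).
Hypothesis mX : measurable_fun setT X.
Hypothesis XG : independent2 P X G.
Hypothesis Xnu : forall A, measurable A -> P (X @^-1` A) = nu A.
Hypothesis Gv : has_mean P G v.
Hypothesis Gs : 'E_P[fun t => (enorm (G t - v) ^+ 2)%R] <= s%:E.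

Let omega0 : (0 <= omega)%R. Proof. by have [] := hQ. Qed.

Let mG : measurable_fun setT G. Proof. exact: has_mean_measurable Gv. Qed.

Let X' : {mfun T >-> S} := HB.pack X (isMeasurableFun.Build _ _ _ _ _ mX).
Let G' : {mfun T >-> 'rV[R]_d} :=
  HB.pack G (isMeasurableFun.Build _ _ _ _ _ mG).

Let mQ : measurable_fun setT (fun p : S * 'rV[R]_d => Q p.1 p.2).
Proof. by have [] := hQ. Qed.

Let mXG : measurable_fun setT (fun t => (X t, G t)).
Proof. exact: measurable_fun_pair. Qed.

Lemma measurable_quantized : measurable_fun setT (fun t => Q (X t) (G t)).
Proof. exact: (measurableT_comp mQ mXG). Qed.

(** The compressor is controlled at deterministic vectors; since the seed [X] is independent of [G],
    it can be integrated first with [G t] frozen. *)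
Lemma quantization_error_le :
  'E_P[fun t => (enorm (Q (X t) (G t) - G t) ^+ 2)%R] <=
  omega%:E * 'E_P[fun t => (enorm (G t) ^+ 2)%R].
Proof.
pose f (p : S * 'rV[R]_d) := (enorm (Q p.1 p.2 - p.2) ^+ 2)%:E.
have mf : measurable_fun setT f.
  apply/measurable_EFinP; apply: measurable_enorm_sqr.
  exact: measurable_fun_rVB.
have f0 p : 0 <= f p by rewrite lee_fin sqr_ge0.
have mGG : measurable_fun setT (fun t => (enorm (G t) ^+ 2)%:E).
  by apply/measurable_EFinP; exact: measurable_enorm_sqr.
rewrite unlock -ge0_integralZl_EFin//; last first.
  by move=> t _; rewrite lee_fin sqr_ge0.
rewrite (ge0_integral_independent2 (U := X') (V := G') XG Xnu mf f0).
apply: ge0_le_integral => //.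
- by move=> t _; exact: integral_ge0.
- have mF : measurable_fun setT (fun u => \int[nu]_a f (a, u)).
    exact: measurable_fun_fubini_tonelli_G.
  exact: (measurableT_comp mF mG).
- exact: measurable_funeM.
- move=> t _; have [_ _ _ /(_ (G t))] := hQ.
  by rewrite unlock EFinM.
Qed.

(** Splitting [Q(G) - v] at [G] costs a factor 2, and so does splitting [G] at [v] inside [E |G|^2].
    The total is [2 omega (2 s + 2 |v|^2) + 2 s]. *)
Lemma quantized_error_le :
  'E_P[fun t => (enorm (Q (X t) (G t) - v) ^+ 2)%R] <=
  ((2 + 4 * omega) * s + 4 * omega * enorm v ^+ 2)%:E.
Proof.
have mGv : measurable_fun setT (fun t => G t - v)%R.
  by apply: measurable_fun_rVB => //; exact: measurable_cst.
have mQG : measurable_fun setT (fun t => Q (X t) (G t) - G t)%R.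
  by apply: measurable_fun_rVB => //; exact: measurable_quantized.
have G2 : 'E_P[fun t => (enorm (G t) ^+ 2)%R] <= (2 * s + 2 * enorm v ^+ 2)%:E.
  have := expectation_enorm_sqrD_le P mGv (measurable_cst v).
  rewrite (_ : (fun t => _) = (fun t => (enorm (G t) ^+ 2)%R)); last first.
    by apply/funext => t; rewrite /= subrK.
  move=> /le_trans; apply.
  rewrite (expectation_cst P (enorm v ^+ 2)) [leRHS]EFinD !(EFinM 2).
  by apply: leeD => //; rewrite lee_pmul2l// lte_fin.
have := expectation_enorm_sqrD_le P mQG mGv.
rewrite (_ : (fun t => _) = (fun t => (enorm (Q (X t) (G t) - v) ^+ 2)%R));
  last first.
  by apply/funext => t; rewrite addrA subrK.
move=> /le_trans; apply.
apply: (@le_trans _ _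
  (2%:E * (omega%:E * (2 * s + 2 * enorm v ^+ 2)%:E) + 2%:E * s%:E)).
  apply: leeD; rewrite lee_pmul2l ?lte_fin//.
  apply: (le_trans quantization_error_le).
  by rewrite lee_wpmul2l// lee_fin.
by rewrite -!EFinM -EFinD lee_fin; lra.
Qed.

(** Averaging over the seed first gives [G], and averaging [G] then gives [v]. The integrability
    that Fubini requires comes from the finite second moment of [quantized_error_le]. *)
Lemma has_mean_quantized : has_mean P (fun t => Q (X t) (G t)) v.
Proof.
move=> j.
have Q2 : (fun t => Q (X t) (G t) ord0 j) \in Lfun P 2%:E.
  apply: (Lfun2_coord (m := v) j measurable_quantized).
  exact: le_lt_trans quantized_error_le (ltry _).
have iQ : P.-integrable setT (fun t => (Q (X t) (G t) ord0 j)%:E).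
  apply/Lfun1_integrable; apply: Lfun_subset12 Q2.
  exact: fin_num_measure P _ measurableT.
split => //; have [iG <-] := Gv j; rewrite unlock.
transitivity (\int[distribution P G']_u \int[nu]_a (Q a u ord0 j)%:E).
  apply: (integral_independent2 (U := X') (V := G') XG Xnu
    (f := fun p : S * 'rV[R]_d => (Q p.1 p.2 ord0 j)%:E)) => //.
  by apply/measurable_EFinP; exact: measurable_fun_coord.
transitivity (\int[distribution P G']_u (u ord0 j)%:E).
  apply: eq_integral => u _; have [_ _ /(_ u j)[_] + _] := hQ.
  by rewrite unlock.
rewrite integral_distribution//.
by apply/measurable_EFinP; exact: measurable_coord.
Qed.

End quantization.

(** * From mutual independence of all seeds and estimators to pairs *)

Section mutual_independence.
Local Open Scope ereal_scope.
Context {R : realType} {dT : measure_display} {T : measurableType dT}.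
Variable P : probability T R.

(** All three probabilities are products over index sets, and the product over a disjoint union
    splits. *)
Lemma mutually_independent_disjoint {I : finType} (G : I -> set (set T))
    (J1 J2 : {set I}) (E : I -> set T) :
  mutually_independent P G -> [disjoint J1 & J2]%B -> (forall i, G i (E i)) ->
  P (\bigcap_(i in [set` J1]) E i `&` \bigcap_(i in [set` J2]) E i) =
  P (\bigcap_(i in [set` J1]) E i) * P (\bigcap_(i in [set` J2]) E i).
Proof.
move=> indep J12 GE; rewrite -bigcap_setU.
have -> : [set` J1] `|` [set` J2] = [set` (J1 :|: J2)%SET].
  by apply/seteqP; split => i /=; rewrite finset.in_setU => /orP.
rewrite !indep// -bigU//=; apply: eq_bigl => i.
by rewrite !inE.
Qed.

Variables (n : nat) (dS dU : measure_display) (S : measurableType dS)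
  (U : measurableType dU) (X : 'I_n -> T -> S) (G : 'I_n -> T -> U).
Hypothesis indep : mutually_independent P (fun a : 'I_n + 'I_n =>
  match a with
  | inl i => g_sigma_algebra_preimage (G i)
  | inr i => g_sigma_algebra_preimage (X i)
  end).

(** One event per source of randomness, in the indexing of [indep], so that rectangle events become
    intersections over small index sets. *)
Let event (A : 'I_n -> set S) (B : 'I_n -> set U) (a : 'I_n + 'I_n) :=
  match a with inl i => G i @^-1` B i | inr i => X i @^-1` A i end.

Let event_mem A B a : (forall i, measurable (A i)) ->
  (forall i, measurable (B i)) ->
  match a with
  | inl i => g_sigma_algebra_preimage (G i)
  | inr i => g_sigma_algebra_preimage (X i)
  end (event A B a).
Proof.
by move=> mA mB; case: a => i /=; [exists (B i)|exists (A i)];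
  rewrite ?setTI.
Qed.

Let bigcap_event1 A B a :
  \bigcap_(b in [set` [set a]%SET]) event A B b = event A B a.
Proof.
apply/seteqP; split => [t /(_ a)|t Et b /=]; first by apply; rewrite /= inE.
by rewrite inE => /eqP ->.
Qed.

Let bigcap_event2 A B i :
  \bigcap_(b in [set` [set inr i; inl i]%SET]) event A B b =
  X i @^-1` A i `&` G i @^-1` B i.
Proof.
apply/seteqP; split => [t Et|t [XA GB] b /=].
  by split; [apply: (Et (inr i))|apply: (Et (inl i))];
    rewrite /= !inE eqxx ?orbT.
by rewrite !inE => /orP[] /eqP ->.
Qed.

Lemma mutually_independent_pair i : independent2 P (X i) (G i).
Proof.
move=> A B mA mB.
have := mutually_independent_disjoint (J1 := [set inr i]) (J2 := [set inl i])
  (E := event (fun=> A) (fun=> B)) indep.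
rewrite !bigcap_event1; apply; last by move=> a; exact: event_mem.
by rewrite finset.disjoints1 inE.
Qed.

Lemma mutually_independent_pairs i k : i != k ->
  (forall j, measurable_fun setT (X j)) ->
  (forall j, measurable_fun setT (G j)) ->
  independent2 P (fun t => (X i t, G i t)) (fun t => (X k t, G k t)).
Proof.
move=> ik mX mG; apply: independent2_pairs => // A B A' B' mA mB mA' mB'.
(* Testing [j == i] lets a single family carry [A], [B] for worker [i] and [A'], [B'] for worker
   [k]. *)
have := mutually_independent_disjoint (J1 := [set inr i; inl i])
  (J2 := [set inr k; inl k]) (E := event (fun j => if j == i then A else A')
    (fun j => if j == i then B else B')) indep.
rewrite !bigcap_event2 eqxx eq_sym (negbTE ik); apply.
- apply/pred0P => -[j|j] /=; rewrite !inE /=; apply/negbTE/negP.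
  + by move=> /andP[/eqP[->] /eqP[ki]]; rewrite ki eqxx in ik.
  + move=> /andP[]; rewrite !orbF => /eqP[->] /eqP[ki].
    by rewrite ki eqxx in ik.
- by move=> a; apply: event_mem => j; case: ifP.
Qed.

End mutual_independence.

(** * Iterates of QSGDA and verification of the key assumption *)

Lemma qsgda_x_known_before (R : realType) (d n : nat) (Om S : Type)
    (r : 'rV[R]_d -> \bar R) (gamma : R) (x0 : 'rV[R]_d)
    (Q : S -> 'rV[R]_d -> 'rV[R]_d) (xi : nat -> 'I_n -> Om -> S)
    (g : nat -> 'I_n -> (nat -> Om) -> 'rV[R]_d) :
  (forall k i, known_before k.+1 (g k i)) ->
  forall k, known_before k (qsgda_x r gamma x0 Q xi g k).
Proof.
(* Passing from [k] to [k.+1] brings in only the seeds, read from [w k], and the estimators, known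
   before [k.+1]. *)
move=> hg; elim=> [//|k IHk] w w' ww' /=.
rewrite (IHk w w') => [|m mk]; last by apply: ww'; exact: ltnW.
suff -> : qsgda_g Q xi g k w = qsgda_g Q xi g k w' by [].
apply: (congr1 (@average R d n)); apply/funext => i.
by rewrite ww'// (hg k i w w').
Qed.

Theorem proposition5p3 (R : realType) (d n : nat) (hn : (0 < n)%N)
    (* operators, regularizer, solution set *)
    (Fi : 'I_n -> 'rV[R]_d -> 'rV[R]_d) (F : 'rV[R]_d -> 'rV[R]_d)
    (hF : forall x : 'rV[R]_d, F x = average (fun i => Fi i x))
    (r : 'rV[R]_d -> \bar R)
    (hr_proper : proper_ereal r) (hr_lsc : lower_semicontinuous r)
    (hr_convex : convex_ereal r)
    (Xs : set 'rV[R]_d) (hXs : Xs = VI_solutions F r) (hXs0 : Xs !=set0)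
    (hproj : forall x : 'rV[R]_d, argmin Xs (fun y => enorm (y - x)) !=set0)
    (* cocoercivity *)
    (l : R) (hl : 0 < l) (hcoco : star_cocoercive F Xs l)
    (lhat : R) (hlhat : 0 < lhat)
    (havg : forall x : 'rV[R]_d, let xs := proj_set Xs x in
      n%:R^-1 * \sum_(i < n) enorm (Fi i x - Fi i xs) ^+ 2 <=
      lhat * inner (F x - F xs) (x - xs))
    (* randomness and compressor *)
    (dOm : measure_display) (Om : measurableType dOm)
    (P : nat -> probability Om R)
    (dS : measure_display) (S : measurableType dS) (nu : probability S R)
    (Q : S -> 'rV[R]_d -> 'rV[R]_d) (omega : R)
    (hQ : unbiased_compressor nu Q omega)
    (* QSGDA *)
    (gamma : R) (hgamma : 0 < gamma) (x0 : 'rV[R]_d)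
    (xi : nat -> 'I_n -> Om -> S)
    (gi : nat -> 'I_n -> (nat -> Om) -> 'rV[R]_d)
    (hgi : forall k i, known_before k.+1 (gi k i))
    (hindep : independent_workers P nu xi gi)
    (x : nat -> (nat -> Om) -> 'rV[R]_d) (hx : x = qsgda_x r gamma x0 Q xi gi)
    (g : nat -> (nat -> Om) -> 'rV[R]_d) (hg : g = qsgda_g Q xi gi)
    (* unbiased estimators with bounded variance *)
    (sigma : 'I_n -> R)
    (hunb : forall k i w, E_iter_vec P k (gi k i) w (Fi i (x k w)))
    (hvar : forall k i w,
      (E_iter P k (fun w' => (enorm (gi k i w' - Fi i (x k w')) ^+ 2)%R) w <=
       (sigma i ^+ 2)%:E)%E)
    (* the maximum in the definition of zeta_*^2 *)
    (zmax : R)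
    (hzmax : is_max [set \sum_(i < n) enorm (Fi i xs) ^+ 2 | xs in Xs] zmax) :
  let sigma2 := n%:R^-1 * \sum_(i < n) sigma i ^+ 2 in
  let zeta2 := n%:R^-1 * zmax in
  key_assumption P F Xs x g (fun _ _ => 0)
    (3 * l / 2 + 9 * omega * lhat / (2 * n%:R))       (* A *)
    0                                                 (* B *)
    0                                                 (* C *)
    ((3 * (1 + 3 * omega) * sigma2 + 9 * omega * zeta2) / n%:R)  (* D1 *)
    0                                                 (* D2 *)
    1.                                                (* rho *)
Proof.
move=> sigma2 zeta2.
have [omega0 _ _ _] := hQ.
have a_gt0 : 0 < n%:R^-1 :> R by rewrite invr_gt0 ltr0n.
have sigma0 : 0 <= \sum_(i < n) sigma i ^+ 2.
  by apply: sumr_ge0 => i _; exact: sqr_ge0.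
have zmax0 : 0 <= zmax.
  by case: hzmax => -[xs _ <-] _; apply: sumr_ge0 => i _; exact: sqr_ge0.
(* [x k] depends on earlier draws only, so it is a constant for [E_k]. *)
have xR k w s : x k (resample w k s) = x k w.
  rewrite hx; apply: qsgda_x_known_before => // m mk.
  by rewrite /resample /= ltn_eqF.
have [mxi xinu mutual] := hindep.
(* The estimator as a function of the fresh draw [s], the past of [w] being fixed. *)
pose G k w i s := gi k i (resample w k s).
have gR k w s :
    g k (resample w k s) = average (fun i => Q (xi k i s) (G k w i s)).
  rewrite hg /qsgda_g; apply: (congr1 (@average R d n)); apply/funext => i.
  by rewrite /G /resample /= eqxx.
have Gmean k w i : has_mean (P k) (G k w i) (Fi i (x k w)) := hunb k i w.
have mG k w i := has_mean_measurable (Gmean k w i).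
have Gvar k w i :
    ('E_(P k)[fun s => (enorm (G k w i s - Fi i (x k w)) ^+ 2)%R] <=
     (sigma i ^+ 2)%:E)%E.
  apply: le_trans (hvar k i w); rewrite /E_iter.
  by under [in leRHS]eq_fun do rewrite xR.
have pair k w i : independent2 (P k) (xi k i) (G k w i).
  exact: (mutually_independent_pair (mutual k w)).
pose W k w i s := Q (xi k i s) (G k w i s).
have Wmean k w i : has_mean (P k) (W k w i) (Fi i (x k w)).
  exact: (has_mean_quantized hQ (mxi k i) (pair k w i) (xinu k i)
    (Gmean k w i) (Gvar k w i)).
have Werr k w i := quantized_error_le hQ (mxi k i) (pair k w i) (xinu k i)
    (Gmean k w i) (Gvar k w i).
have Windep k w i j : i != j -> independent2 (P k) (W k w i) (W k w j).
  (* Joint measurability of [Q] transfers independence from the pairs (seed, estimator) to the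
     quantized vectors. *)
  move=> ij; have [_ mQ _ _] := hQ.
  exact: (independent2_comp mQ mQ
    (mutually_independent_pairs (mutual k w) ij (mxi k) (mG k w))).
(* By star-cocoercivity, [l] times this inner product dominates a square. *)
have ip0 y : 0 <= inner (F y - F (proj_set Xs y)) (y - proj_set Xs y).
  rewrite -(pmulr_rge0 _ hl); apply: le_trans (hcoco y); exact: sqr_ge0.
split.
- split=> //.
  + by rewrite !(addr_ge0, divr_ge0, mulr_ge0)// ltW.
  + by rewrite !(divr_ge0, addr_ge0, mulr_ge0)// ltW.
- by rewrite ltr01 lexx.
- by move=> k; split => // w; exact: measurable_cst.
- move=> k w; rewrite /E_iter_vec.
  under eq_fun do rewrite gR.
  by rewrite hF; exact: (has_mean_average (Wmean k w)).
- move=> k w; rewrite /E_iter; under eq_fun do rewrite xR gR.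
  set y := x k w; set ys := proj_set Xs y.
  rewrite (expectation_enorm_average_sub (F ys) (Wmean k w) _ (Windep k w));
    last first.
    by move=> i; exact: le_lt_trans (Werr k w i) (ltry _).
  (* [F_i(y)] is split at [F_i(ys)]: [havg] controls the difference and [zmax] the rest. *)
  have Fi_le i : enorm (Fi i y) ^+ 2 <=
      2 * enorm (Fi i y - Fi i ys) ^+ 2 + 2 * enorm (Fi i ys) ^+ 2.
    by rewrite -[X in enorm X ^+ 2 <= _](subrK (Fi i ys)); exact: enorm_sqrD_le.
  (* By [hproj] the argmin is nonempty, so [ys] is a true projection and not the default 0 of
     [xget]; hence it lies in [Xs]. *)
  have zeta_le : \sum_(i < n) enorm (Fi i ys) ^+ 2 <= zmax.
    apply: (proj2 hzmax); exists ys => //.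
    by have [+ _] := xgetPex 0 (hproj y).
  have sumF_le : \sum_(i < n) enorm (Fi i y) ^+ 2 <=
      2 * \sum_(i < n) enorm (Fi i y - Fi i ys) ^+ 2 + 2 * zmax.
    apply: (@le_trans _ _ (2 * \sum_(i < n) enorm (Fi i y - Fi i ys) ^+ 2 +
      2 * \sum_(i < n) enorm (Fi i ys) ^+ 2)); last by rewrite lerD2l ler_pM2l.
    by rewrite !mulr_sumr -big_split; apply: ler_sum => i _; exact: Fi_le.
  (* The bound of [quantized_error_le] with [s = sigma_i^2] and [v = F_i(y)]. *)
  pose e i := (2 + 4 * omega) * sigma i ^+ 2 + 4 * omega * enorm (Fi i y) ^+ 2.
  apply: (@le_trans _ _
    (enorm (F y - F ys) ^+ 2 + n%:R^-1 ^+ 2 * \sum_(i < n) e i)%:E).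
    rewrite EFinD (EFinM (n%:R^-1 ^+ 2)) -sumEFin -hF leeD2lE//.
    by rewrite lee_wpmul2l// ?lee_fin ?sqr_ge0//; apply: lee_sum => i _;
      exact: Werr.
  rewrite lee_fin /e big_split/= -!mulr_sumr.
  have := hcoco y; have := havg y; have := ip0 y; rewrite /= -/ys invfM.
  rewrite /sigma2 /zeta2.
  (* Only an inequality between reals remains: the inner product, the norms and the sums become
     variables, and [a] stands for [1/n]. *)
  move: (inner _ _) (enorm (F y - F ys) ^+ 2)
    (\sum_(i < n) enorm (Fi i y - Fi i ys) ^+ 2)
    (\sum_(i < n) enorm (Fi i y) ^+ 2) (\sum_(i < n) sigma i ^+ 2) n%:R^-1
    sumF_le sigma0 a_gt0.
  move=> ip b D E s a; clear - omega0 zmax0 hl hlhat.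
  move=> ED s0 a0 i0 Dl bl.
  have p0 : 0 <= omega * a by rewrite mulr_ge0// ltW.
  have pa0 : 0 <= omega * a * a by rewrite mulr_ge0// ltW.
  (* [h2] trades [E] for [D] and [zmax], and [h1] trades [D] for [ip]; [h3] to [h7] are the slack in
     the constants. Adding [bl] to [8 h1 + 4 h2 + h3 + h4 + 5 h5 + h6 + 2 h7] gives the goal. *)
  have h1 : 0 <= (omega * a) * (lhat * ip - a * D).
    by rewrite mulr_ge0// subr_ge0.
  have h2 : 0 <= (omega * a * a) * (2 * D + 2 * zmax - E).
    by rewrite mulr_ge0// subr_ge0.
  have h3 : 0 <= (omega * a) * (lhat * ip) by rewrite !mulr_ge0// ltW.
  have h4 : 0 <= (omega * a * a) * zmax by rewrite mulr_ge0.
  have h5 : 0 <= (omega * a * a) * s by rewrite mulr_ge0.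
  have h6 : 0 <= a * a * s by rewrite !mulr_ge0// ltW.
  have h7 : 0 <= l * ip by rewrite mulr_ge0// ltW.
  lra.
- move=> k w; rewrite /E_iter.
  by rewrite expr0n /= (expectation_cst (P k) 0) !(mulr0, mul0r, addr0).
Qed.
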